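(* Given a scalar $\rho$, assume that there exist matrices $P \in \mathbb{S}_{3n}^{+}$, $W_1, W_2, Z_1, Z_2 \in \mathbb{S}_{n}^{+}$, $R \in \mathbb{S}_{m}^{+}$, a symmetric matrix $Q \in \mathbb{R}^{p \times p}$, and matrices $S \in \mathbb{R}^{p \times m}$ and $X \in \mathbb{R}^{2n\times 2n}$ such that \begin{equation*} \Psi_z \succ 0, \qquad \Gamma^{\perp\top}\left(\bar{\Phi}(d)+\Upsilon \right) \Gamma^{\perp} \prec 0, \end{equation*} \begin{equation*} \begin{bmatrix} Q + \rho \mathbf{1}_{p \times m} S^\top + S \rho \mathbf{1}_{m \times p} & \star \\ R^\top \rho \mathbf{1}_{m \times p} & -R \end{bmatrix} \prec 0, \end{equation*} hold for $d=d_m$ and $d=d_M$, where \begin{equation*} \Gamma^{\perp} = \begin{bmatrix} \begin{bmatrix} A & 0_{n \times 6n} & B \end{bmatrix} \\ I_{7n+m} \end{bmatrix} \in \mathbb{R}^{(8n+m)\times(7n+m)} \end{equation*} (the block row $[A~~0_{n\times 6n}~~B]$ stacked on top of the identity $I_{7n+m}$), \begin{equation*} \begin{split} &\Upsilon = \Upsilon_1 + \Upsilon_2 + \Upsilon_2^{\top}, \\ &\Upsilon_1 = \mathrm{diag}(0_{3n \times 3n},-C^{\top} Q C,0_{4n \times 4n},-R), \\ &\Upsilon_2 = \begin{bmatrix} 0_{n \times 3n} & I & 0_{n \times (4n+m)} \end{bmatrix}^{\top} \begin{bmatrix} 0_{n \times 8n} & -C^{\top} S \end{bmatrix}, \end{split}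 \end{equation*} and \begin{equation*} \begin{split} \bar{\Phi}(d)&=\mathrm{diag}\{\Phi(d),0_{m \times m}\}, \\ \Phi(d) &= F_{2}^{\top}PF_{2} -F_{1}^{\top}PF_{1} + \mathrm{He}\{F^{\top}(d)P(F_2-F_1)\}+W \\ &\quad +F_3^{\top}(d_m^2 Z_1+d_{\Delta}^2 Z_2) F_3-F_{s}^{\top} \mathscr{Z}_1(d_m)F_{s}-F_{\Psi}^{\top}\Psi_zF_{\Psi}, \end{split} \end{equation*} with $\mathrm{He}\{Y\}=Y+Y^{\top}$, $d_\Delta = d_M-d_m$, \begin{equation*} W = \mathrm{diag}(0,W_1,W_2-W_1,0,-W_2,0,0,0), \end{equation*} \begin{equation*} \mathscr{Z}_1(d_m) = \mathrm{diag}\left(Z_1,3\gamma(d_m)Z_1\right), \quad \mathscr{Z}_2 = \mathrm{diag}\left(Z_2,3Z_2\right), \end{equation*} where $\gamma(d)=1$ if $d=1$ and $\gamma(d)=(d+1)/(d-1)$ if $d>1$, \begin{equation*} M = \begin{bmatrix} 0 & I & -I & 0 & 0 & 0 \\ 0 & I & I & 0 & 0 & -2I \end{bmatrix}\in\mathbb{R}^{2n\times 6n}, \end{equation*} \begin{equation*} F_{\Psi} = \begin{bmatrix} \begin{bmatrix} 0_{2n\times2n} & M \end{bmatrix} \\ \begin{bmatrix} 0_{2n\times n} & M & 0_{2n\times n} \end{bmatrix} \end{bmatrix}\in\mathbb{R}^{4n\times 8n}, \end{equation*} \begin{equation*} F_{s} = \begin{bmatrix} M & 0_{2n\times2n} \end{bmatrix},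 \quad F_{3} = \begin{bmatrix} I & -I & 0 & 0 & 0 & 0 & 0 & 0 \end{bmatrix}, \end{equation*} \begin{equation*} F_{1} = \begin{bmatrix} 0 & I & 0 & 0 & 0 & 0 & 0 & 0 \\ 0 & -I & 0 & 0 & 0 & (d_m +1)I & 0 & 0 \\ 0 & 0 & -I & -I & 0 & 0& (1-d_m)I & (d_M+1)I \end{bmatrix}, \end{equation*} \begin{equation*} F_{2} = \begin{bmatrix} I & 0 & 0 & 0 & 0 & 0 & 0 & 0 \\ 0 & 0 & -I & 0 & 0 & (d_m +1)I & 0 & 0 \\ 0 & 0 & 0 & -I & -I & 0& (1-d_m)I & (d_M+1)I \end{bmatrix}, \end{equation*} \begin{equation*} F(d) = \begin{bmatrix} 0_{2n \times 6n} & 0_{2n \times n} & 0_{2n \times n} \\ 0_{n \times 6n} & d I_n & -d I_n \end{bmatrix}, \quad \Psi_z = \begin{bmatrix} \mathscr{Z}_2 & X \\ \star & \mathscr{Z}_2 \end{bmatrix}. \end{equation*} Then the SOF gain $K=-R^{-1}S^{\top}$ asymptotically stabilizes the closed-loop system $x(k+1)=Ax(k)+BKCx(k-d(k))$ for any time-varying delay $d_m \leq d(k) \leq d_M$.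
   Context: Consider the discrete-time plant $x(k+1)=Ax(k)+Bu(k-d(k))$, $y(k)=Cx(k)$, $u(k)=\theta_u(k)$ for $k\in[-d_M,-1]$, with $x(k)\in\mathbb{R}^n$, $y(k)\in\mathbb{R}^p$, $u(k)\in\mathbb{R}^m$, constant known matrices $A,B,C$ with $(A,B)$ controllable, and a bounded time-varying delay $d(k)$ satisfying $1\le d_m\le d(k)\le d_M$ with known integers $d_m,d_M$ (the value of $d(k)$ itself is unknown and may vary arbitrarily in this range). The static output feedback law $u(k)=Ky(k)$, $K\in\mathbb{R}^{m\times p}$, gives the closed loop $x(k+1)=Ax(k)+BKCx(k-d(k))$, $x(k)=\phi(k)$ for $k\in[-d_M,0]$. Notation: $\mathbb{S}_n^{+}$ is the set of $n\times n$ symmetric positive definite matrices; $\succ 0$ / $\prec 0$ denote positive / negative definiteness; $\mathbf{1}$ is an all-ones matrix; $\star$ denotes symmetric blocks; unsubscripted $I$ and $0$ blocks in $F_1,F_2,F_3,M,W$ are $n\times n$. *)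

(* Defs.v *)
From HB Require Import structures.
From mathcomp Require Import all_boot all_order all_algebra.
From mathcomp Require Import reals.
Set Implicit Arguments.
Unset Strict Implicit.
Unset Printing Implicit Defensive.
Import Order.TTheory GRing.Theory Num.Theory.

Local Open Scope ring_scope.

Section Defs.
Variable R : realType.

Definition mxget (a b : nat) (M : 'M[R]_(a, b)) (i j : nat) : R :=
  match (insub i : option 'I_a), (insub j : option 'I_b) with
  | Some i', Some j' => M i' j'
  | _, _ => 0
  end.

(* the p x q matrix having the block M at row offset r and column offset c,
   and zeros elsewhere; block matrices are written as sums of such blocks *)
Definition place (p q : nat) (r c : nat) (a b : nat) (M : 'M[R]_(a, b))
  : 'M[R]_(p, q) :=
  \matrix_(i < p, j < q)
    (if (r <= i)%N && (c <= j)%N then mxget M (i - r) (j - c) else 0).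
Arguments place {p q} r c {a b} M.

Definition sI (n : nat) (c : R) : 'M[R]_n := c%:M.

Definition posdef (k : nat) (M : 'M[R]_k) : Prop :=
  M^T = M /\ forall x : 'cV[R]_k, x != 0 -> 0 < (x^T *m M *m x) 0 0.
Definition negdef (k : nat) (M : 'M[R]_k) : Prop := posdef (- M).
Definition symmx (k : nat) (M : 'M[R]_k) : Prop := M^T = M.

Definition ones (a b : nat) : 'M[R]_(a, b) := const_mx 1.

(* controllability of (A,B): rank [B, AB, ..., A^(n-1) B] = n *)
Definition ctrb (n m : nat) (A : 'M[R]_n) (B : 'M[R]_(n, m)) : 'M[R]_(n, n * m) :=
  \matrix_(i < n, j < n * m) mxget (A ^+ (j %/ m) *m B) i (j %% m).
Definition controllable (n m : nat) (A : 'M[R]_n) (B : 'M[R]_(n, m)) : Prop :=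
  \rank (ctrb A B) = n.

Definition gammad (d : nat) : R :=
  if d == 1%N then 1 else (d%:R + 1) / (d%:R - 1).

Variables (n : nat) (dm dM : nat).

Definition Mmat : 'M[R]_((2 * n)%N, (6 * n)%N) :=
    place 0 (1 * n) (sI n 1) + place 0 (2 * n) (sI n (-1))
  + place n (1 * n) (sI n 1) + place n (2 * n) (sI n 1)
  + place n (5 * n) (sI n (-2)).

Definition FPsi : 'M[R]_((4 * n)%N, (8 * n)%N) :=
  place 0 (2 * n) Mmat + place (2 * n) n Mmat.

Definition Fsm : 'M[R]_((2 * n)%N, (8 * n)%N) := place 0 0 Mmat.

Definition F3 : 'M[R]_(n, (8 * n)%N) :=
  place 0 0 (sI n 1) + place 0 n (sI n (-1)).

Definition F1 : 'M[R]_((3 * n)%N, (8 * n)%N) :=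
    place 0 n (sI n 1)
  + place n n (sI n (-1)) + place n (5 * n) (sI n (dm%:R + 1))
  + place (2 * n) (2 * n) (sI n (-1)) + place (2 * n) (3 * n) (sI n (-1))
  + place (2 * n) (6 * n) (sI n (1 - dm%:R))
  + place (2 * n) (7 * n) (sI n (dM%:R + 1)).

Definition F2 : 'M[R]_((3 * n)%N, (8 * n)%N) :=
    place 0 0 (sI n 1)
  + place n (2 * n) (sI n (-1)) + place n (5 * n) (sI n (dm%:R + 1))
  + place (2 * n) (3 * n) (sI n (-1)) + place (2 * n) (4 * n) (sI n (-1))
  + place (2 * n) (6 * n) (sI n (1 - dm%:R))
  + place (2 * n) (7 * n) (sI n (dM%:R + 1)).

Definition Fd (d : nat) : 'M[R]_((3 * n)%N, (8 * n)%N) :=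
  place (2 * n) (6 * n) (sI n d%:R) + place (2 * n) (7 * n) (sI n (- d%:R)).

Definition Wmat (W1 W2 : 'M[R]_n) : 'M[R]_(8 * n)%N :=
  place n n W1 + place (2 * n) (2 * n) (W2 - W1) + place (4 * n) (4 * n) (- W2).

Definition scrZ1 (Z1 : 'M[R]_n) : 'M[R]_(2 * n)%N :=
  place 0 0 Z1 + place n n ((3 * gammad dm) *: Z1).

Definition scrZ2 (Z2 : 'M[R]_n) : 'M[R]_(2 * n)%N :=
  place 0 0 Z2 + place n n (3 *: Z2).

Definition Psiz (Z2 : 'M[R]_n) (X : 'M[R]_(2 * n)%N) : 'M[R]_(4 * n)%N :=
    place 0 0 (scrZ2 Z2) + place 0 (2 * n) X
  + place (2 * n) 0 X^T + place (2 * n) (2 * n) (scrZ2 Z2).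

Definition He (k : nat) (Y : 'M[R]_k) : 'M[R]_k := Y + Y^T.

Definition Phi (P : 'M[R]_(3 * n)%N) (W1 W2 Z1 Z2 : 'M[R]_n)
  (X : 'M[R]_(2 * n)%N) (d : nat) : 'M[R]_(8 * n)%N :=
    F2^T *m P *m F2 - F1^T *m P *m F1
  + He ((Fd d)^T *m P *m (F2 - F1)) + Wmat W1 W2
  + F3^T *m ((dm%:R ^+ 2) *: Z1 + ((dM - dm)%N%:R ^+ 2) *: Z2) *m F3
  - Fsm^T *m scrZ1 Z1 *m Fsm - FPsi^T *m Psiz Z2 X *m FPsi.

Variables (m p : nat).

Definition Phibar (P : 'M[R]_(3 * n)%N) (W1 W2 Z1 Z2 : 'M[R]_n)
  (X : 'M[R]_(2 * n)%N) (d : nat) : 'M[R]_(8 * n + m)%N :=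
  place 0 0 (Phi P W1 W2 Z1 Z2 X d).

Definition Gperp (A : 'M[R]_n) (B : 'M[R]_(n, m))
  : 'M[R]_((8 * n + m)%N, (7 * n + m)%N) :=
  place 0 0 A + place 0 (7 * n) B + place n 0 (1%:M : 'M[R]_(7 * n + m)%N).

Definition Upsilon1 (C : 'M[R]_(p, n)) (Q : 'M[R]_p) (Rm : 'M[R]_m)
  : 'M[R]_(8 * n + m)%N :=
  place (3 * n) (3 * n) (- (C^T *m Q *m C)) + place (8 * n) (8 * n) (- Rm).

Definition Upsilon2 (C : 'M[R]_(p, n)) (S : 'M[R]_(p, m)) : 'M[R]_(8 * n + m)%N :=
  (place 0 (3 * n) (1%:M : 'M[R]_n) : 'M[R]_(n, 8 * n + m))^T
  *m (place 0 (8 * n) (- (C^T *m S)) : 'M[R]_(n, 8 * n + m)).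

Definition Upsilon (C : 'M[R]_(p, n)) (Q : 'M[R]_p) (Rm : 'M[R]_m)
  (S : 'M[R]_(p, m)) : 'M[R]_(8 * n + m)%N :=
  Upsilon1 C Q Rm + Upsilon2 C S + (Upsilon2 C S)^T.

Definition LMI3 (rho : R) (Q : 'M[R]_p) (Rm : 'M[R]_m) (S : 'M[R]_(p, m))
  : 'M[R]_(p + m) :=
  block_mx (Q + rho *: (ones p m *m S^T) + rho *: (S *m ones m p))
           (Rm^T *m (rho *: ones m p))^T
           (Rm^T *m (rho *: ones m p)) (- Rm).

End Defs.

Definition normsq (R : realType) (k : nat) (v : 'cV[R]_k) : R :=
  \sum_(i < k) v i 0 ^+ 2.

(* x : int -> R^n is a solution of x(k+1) = A x(k) + B K C x(k - d(k)), k >= 0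
   (its values on [-dM, 0] are the initial condition phi) *)
Definition closed_loop_sol (R : realType) (n m p : nat) (A : 'M[R]_n)
  (B : 'M[R]_(n, m)) (K : 'M[R]_(m, p)) (C : 'M[R]_(p, n))
  (d : nat -> nat) (x : int -> 'cV[R]_n) : Prop :=
  forall k : nat,
    x (Posz k.+1) = A *m x (Posz k) + B *m K *m C *m x (Posz k - Posz (d k)).

Definition asymp_stable (R : realType) (n m p : nat) (A : 'M[R]_n)
  (B : 'M[R]_(n, m)) (K : 'M[R]_(m, p)) (C : 'M[R]_(p, n))
  (dM : nat) (d : nat -> nat) : Prop :=
  (forall eps : R, 0 < eps -> exists2 delta : R, 0 < delta &
     forall x, closed_loop_sol A B K C d x ->
       (forall j : int, (- Posz dM <= j <= 0)%R -> normsq (x j) < delta) ->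
       forall k : nat, normsq (x (Posz k)) < eps)
  /\
  (forall x, closed_loop_sol A B K C d x ->
     forall eps : R, 0 < eps -> exists N : nat,
       forall k : nat, (N <= k)%N -> normsq (x (Posz k)) < eps).

(* Main.v *)
Require Import Defs.
From HB Require Import structures.
From mathcomp Require Import all_boot all_order all_algebra.
From mathcomp Require Import boolp classical_sets functions reals zify ring lra.
Import Order.TTheory GRing.Theory Num.Theory.
Local Open Scope ring_scope.

(** Lyapunov-Krasovskii argument. Let xi collect x(k+1), x(k), x(k-dm), x(k-d), x(k-dM)
    and the means of x over [k-dm, k], [k-d, k-dm] and [k-dM, k-d]. The functional lkf is
    a P-weighted quadratic form in x(k) and the sums of x over the two delay windows, plus
    window sums weighted by W1, W2 and double window sums of increments weighted by Z1, Z2.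
    Wirtinger's inequality (Bessel's inequality for two orthogonal weights) on each window
    and the reciprocally convex inequality for Psi_z bound its forward difference by
    xi^T Phi(d) xi, which is affine in d. The Upsilon-form at (xi, u) is the supply rate
    - y^T Q y - 2 y^T S u - u^T R u with y = C x(k-d); it is maximal at u = K y, and the
    third LMI makes it nonnegative at u = rho 1 y. On the kernel of [-I A 0 B], which Gperp
    parametrizes, the LMIs at d = dm and d = dM then make lkf decrease by c |x(k)|^2. *)

Set Implicit Arguments.
Unset Strict Implicit.
Unset Printing Implicit Defensive.

Section BilinearForms.
Variables (R : comNzRingType) (a b : nat).
Implicit Types (M N : 'M[R]_(a, b)) (u : 'cV[R]_a) (v : 'cV[R]_b).

Definition bform M u v : R := (u^T *m M *m v) 0 0.

Lemma bform_is_bilinear M : bilinear_for *%R *%R (bform M).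
Proof.
split=> [v|u] k x y; rewrite /bform.
  by rewrite linearP /= !mulmxDl -!scalemxAl !mxE.
by rewrite linearP /= !mxE.
Qed.

HB.instance Definition _ M :=
  bilinear_isBilinear.Build R 'cV[R]_a 'cV[R]_b R *%R *%R (bform M)
    (bform_is_bilinear M).

Lemma bformD M N u v : bform (M + N) u v = bform M u v + bform N u v.
Proof. by rewrite /bform mulmxDr mulmxDl mxE. Qed.

Lemma bformZ k M u v : bform (k *: M) u v = k * bform M u v.
Proof. by rewrite /bform -scalemxAr -scalemxAl mxE. Qed.

Lemma bformN M u v : bform (- M) u v = - bform M u v.
Proof. by rewrite -scaleN1r bformZ mulN1r. Qed.

End BilinearForms.

Lemma bform_tr (R : comNzRingType) a b (M : 'M[R]_(a, b)) u v :
  bform M^T v u = bform M u v.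
Proof.
by rewrite /bform -(trmxK (v^T *m M^T *m u)) mxE !trmx_mul !trmxK mulmxA.
Qed.

Lemma bform_mulmx (R : comNzRingType) a b c d (F : 'M[R]_(a, c)) (M : 'M[R]_(a, b))
    (G : 'M[R]_(b, d)) u v :
  bform (F^T *m M *m G) u v = bform M (F *m u) (G *m v).
Proof. by rewrite /bform trmx_mul !mulmxA. Qed.

Lemma bform_mulmxr (R : comNzRingType) a b c (M : 'M[R]_(a, b)) (G : 'M[R]_(b, c)) u v :
  bform (M *m G) u v = bform M u (G *m v).
Proof. by rewrite /bform !mulmxA. Qed.

Section QuadraticForms.
Variables (R : comNzRingType) (a : nat).
Implicit Types (M : 'M[R]_a) (u v : 'cV[R]_a).

Definition qform M u : R := bform M u u.

Lemma bformC M u v : M^T = M -> bform M v u = bform M u v.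
Proof. by move=> sM; rewrite -{1}sM bform_tr. Qed.

Lemma qform0 M : qform M 0 = 0.
Proof. exact: linear0r. Qed.

Lemma qformZ M k u : qform M (k *: u) = k ^+ 2 * qform M u.
Proof. by rewrite /qform linearZl_LR linearZr_LR /= mulrA expr2. Qed.

Lemma qformB M u v : M^T = M -> qform M (u - v) = qform M u - 2 * bform M u v + qform M v.
Proof. by move=> sM; rewrite /qform linearBl !linearBr /= (bformC u v sM); ring. Qed.

End QuadraticForms.

Lemma qform_block_mx (R : comNzRingType) a b (E : 'M[R]_a) (F : 'M[R]_(a, b))
    (G : 'M[R]_(b, a)) (H : 'M[R]_b) x y :
  qform (block_mx E F G H) (col_mx x y) =
  qform E x + bform F x y + bform G y x + qform H y.
Proof.
rewrite /qform /bform tr_col_mx mul_row_block mul_row_col !mulmxDl !mxE.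
by rewrite -!addrA; congr (_ + _); rewrite addrCA.
Qed.

Lemma normsqE (R : realType) a (u : 'cV[R]_a) : normsq u = qform 1%:M u.
Proof. by rewrite /qform /bform mulmx1 mxE; apply: eq_bigr => i _; rewrite mxE expr2. Qed.

Lemma normsq_mulmx (R : realType) a b (F : 'M[R]_(b, a)) u :
  normsq (F *m u) = qform (F^T *m F) u.
Proof. by rewrite normsqE /qform -[F^T]mulmx1 bform_mulmx. Qed.

Section PositiveDefinite.
Variables (R : realType) (a : nat).
Implicit Types (M : 'M[R]_a) (u v : 'cV[R]_a).

Lemma normsq_ge0 u : 0 <= normsq u.
Proof. by apply: sumr_ge0 => i _; rewrite sqr_ge0. Qed.

Lemma sqr_le_normsq u i : u i 0 ^+ 2 <= normsq u.
Proof. by rewrite /normsq (bigD1 i) //= lerDl sumr_ge0 // => j _; rewrite sqr_ge0. Qed.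

Lemma normsqD_le u v : normsq (u + v) <= 2 * (normsq u + normsq v).
Proof.
rewrite /normsq -big_split mulr_sumr; apply: ler_sum => i _ /=; rewrite mxE.
by have := sqr_ge0 (u i 0 - v i 0); lra.
Qed.

Lemma qform_le_normsq M : exists2 c : R, 0 <= c & forall u, qform M u <= c * normsq u.
Proof.
exists (\sum_i \sum_j `|M j i|); first by apply: sumr_ge0 => i _; apply: sumr_ge0.
move=> u; rewrite /qform /bform mxE mulr_suml; apply: ler_sum => i _.
rewrite mxE !mulr_suml; apply: ler_sum => j _; rewrite mxE mulrAC mulrC.
have uij_le : `|u j 0 * u i 0| <= normsq u.
  have := sqr_le_normsq u i; have := sqr_le_normsq u j.
  have := sqr_ge0 (u j 0 - u i 0); have := sqr_ge0 (u j 0 + u i 0).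
  by rewrite ler_norml; move=> *; apply/andP; split; lra.
by apply: le_trans (ler_norm _) _; rewrite normrM ler_wpM2l.
Qed.

Lemma posdef_ge0 M u : posdef M -> 0 <= qform M u.
Proof.
move=> [_ pM]; have [->|u0] := eqVneq u 0; first by rewrite qform0.
by rewrite ltW // pM.
Qed.

Lemma posdef_cauchy M u v : posdef M -> bform M u v ^+ 2 <= qform M u * qform M v.
Proof.
move=> pM; have [sM pM'] := pM.
have [->|v0] := eqVneq v 0; first by rewrite qform0 linear0r expr0n mulr0.
have qv : 0 < qform M v by exact: pM'.
have := posdef_ge0 (qform M v *: u - bform M u v *: v) pM.
rewrite qformB // !qformZ linearZl_LR linearZr_LR /= => discr.
have {}discr : 0 <= qform M v * (qform M u * qform M v - bform M u v ^+ 2) by lra.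
by rewrite -subr_ge0 -(pmulr_rge0 _ qv).
Qed.

Lemma posdef_unitmx M : posdef M -> M \in unitmx.
Proof.
move=> [_ pM]; rewrite -row_free_unit -kermx_eq0; apply/eqP/row_matrixP => i.
rewrite row0; apply/eqP; case: (boolP (_ == 0)) => // ker_neq0.
have /pM : (row i (kermx M))^T != 0 by rewrite -trmx0 (inj_eq trmx_inj).
by rewrite trmxK -row_mul mulmx_ker row0 mul0mx mxE ltxx.
Qed.

(* Cauchy-Schwarz in the inner product of M, applied to the dual basis
   M^-1 e_i, bounds every coordinate of u by qform M u. *)
Lemma posdef_coercive M : posdef M ->
  exists2 c : R, 0 < c & forall u, c * normsq u <= qform M u.
Proof.
move=> pM; pose e i := invmx M *m delta_mx i 0 : 'cV[R]_a.
pose t := \sum_i qform M (e i).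
have t0 : 0 <= t by apply: sumr_ge0 => i _; exact: posdef_ge0.
exists (t + 1)^-1 => [|u]; first by rewrite invr_gt0; lra.
rewrite mulrC ler_pdivrMr; last lra.
apply: (@le_trans _ _ (qform M u * t)); last by rewrite ler_wpM2l ?posdef_ge0 //; lra.
rewrite /normsq /t mulr_sumr; apply: ler_sum => i _.
have -> : u i 0 = bform M u (e i).
  rewrite /bform -mulmxA mulKVmx ?posdef_unitmx // mxE (bigD1 i) //= big1 => [|j ji].
    by rewrite !mxE !eqxx mulr1 addr0.
  by rewrite !mxE (negbTE ji) mulr0.
exact: posdef_cauchy.
Qed.

Lemma posdef_coercive_mulmx b M (F : 'M[R]_(b, a)) : posdef M ->
  exists2 c : R, 0 < c & forall u, c * normsq (F *m u) <= qform M u.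
Proof.
move=> /posdef_coercive[c c0 coer]; have [k k0 bnd] := qform_le_normsq (F^T *m F).
have k1 : 0 < k + 1 by lra.
exists (c / (k + 1)) => [|u]; first exact: divr_gt0.
apply: le_trans (coer u); rewrite -mulrA ler_pM2l // mulrC ler_pdivrMr //.
by rewrite normsq_mulmx; have := bnd u; have := normsq_ge0 u; lra.
Qed.

End PositiveDefinite.

Section Slices.
Variable R : pzRingType.

Definition slice_mx (p r a : nat) : 'M[R]_(a, p) :=
  \matrix_(i < a, j < p) (j == r + i :> nat)%N%:R.

Definition slice (p r a : nat) (v : 'cV[R]_p) : 'cV[R]_a := slice_mx p r a *m v.

Lemma sliceD p r a (u v : 'cV[R]_p) : slice r a (u + v) = slice r a u + slice r a v.
Proof. exact: mulmxDr. Qed.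

Lemma sliceE p r a (v : 'cV[R]_p) (i : 'I_a) (j : 'I_p) :
  j = (r + i)%N :> nat -> slice r a v i 0 = v j 0.
Proof.
move=> jE; rewrite /slice mxE (bigD1 j) //= mxE jE eqxx mul1r big1 ?addr0 // => k kj.
by rewrite mxE -jE -[_ == _]/(k == j) (negbTE kj) mul0r.
Qed.

Lemma slice_id a (v : 'cV[R]_a) : slice 0 a v = v.
Proof. by apply/colP => i; rewrite (sliceE v (j := i)). Qed.

Lemma slice_slice p r a s b (v : 'cV[R]_p) : (r + a <= b)%N -> (s + b <= p)%N ->
  slice r a (slice s b v) = slice (s + r) a v.
Proof.
move=> rab sbp; apply/colP => i; have i_a := ltn_ord i.
have ri_b : (r + i < b)%N by lia.
have sri_p : (s + r + i < p)%N by lia.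
by rewrite (sliceE _ (j := Ordinal ri_b)) // !(sliceE v (j := Ordinal sri_p)) //= addnA.
Qed.

Lemma slice_inj p (u v : 'cV[R]_p) :
  (forall i, (i < p)%N -> exists r a, (r <= i < r + a)%N /\ slice r a u = slice r a v) ->
  u = v.
Proof.
move=> cover; apply/colP => i; have [r [a [/andP[ri ira] uv]]] := cover i (ltn_ord i).
have ir_a : (i - r < a)%N by lia.
by rewrite -!(@sliceE _ r a _ (Ordinal ir_a) i) ?uv //= subnKC.
Qed.

Lemma slice_col_mxu a b (u : 'cV[R]_a) (v : 'cV[R]_b) : slice 0 a (col_mx u v) = u.
Proof. by apply/colP => i; rewrite (sliceE _ (j := lshift b i)) // col_mxEu. Qed.

Lemma slice_col_mxd a b (u : 'cV[R]_a) (v : 'cV[R]_b) : slice a b (col_mx u v) = v.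
Proof. by apply/colP => i; rewrite (sliceE _ (j := rshift a i)) // col_mxEd. Qed.

Lemma slice_mx_mul_tr p r a : (r + a <= p)%N ->
  slice_mx p r a *m (slice_mx p r a)^T = 1%:M.
Proof.
move=> rap; apply/matrixP => i j; rewrite !mxE.
have ri_p : (r + i < p)%N by have := ltn_ord i; lia.
rewrite (bigD1 (Ordinal ri_p)) //= !mxE /= eqxx mul1r eqn_add2l big1 ?addr0 // => k kri.
by rewrite !mxE -[_ == _ :> nat]/(k == Ordinal ri_p) (negbTE kri) mul0r.
Qed.

Lemma slice_mx_mul_tr0 p r a s b : (r + a <= s)%N || (s + b <= r)%N ->
  slice_mx p r a *m (slice_mx p s b)^T = 0.
Proof.
move=> disj; apply/matrixP => i j; rewrite !mxE big1 // => k _; rewrite !mxE -natrM mulnb.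
by have := ltn_ord i; have := ltn_ord j; case: eqP => [->|//]; case: eqP => //; lia.
Qed.

End Slices.

Section Blocks.
Variable R : realType.

Lemma tr_slice_mx_mulE p r a b (M : 'M[R]_(a, b)) i j :
  ((slice_mx R p r a)^T *m M) i j = if (r <= i)%N then mxget M (i - r) j else 0.
Proof.
rewrite mxE; case: leqP => [ri|ir]; last first.
  by rewrite big1 // => k _; rewrite !mxE; case: eqP => [|_]; [lia | rewrite mul0r].
rewrite /mxget valK; case: insubP => [k _ kE|ir_a].
  rewrite (bigD1 k) //= !mxE kE subnKC // eqxx mul1r big1 ?addr0 // => l lk.
  rewrite !mxE; case: eqP => [iE|_]; last by rewrite mul0r.
  by case/eqP: lk; apply/val_inj; rewrite /= kE iE addKn.
rewrite big1 // => k _; rewrite !mxE; case: eqP => [iE|_]; last by rewrite mul0r.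
by have := ltn_ord k; lia.
Qed.

Lemma place_slice_mx p q r c a b (M : 'M[R]_(a, b)) :
  place p q r c M = (slice_mx R p r a)^T *m M *m slice_mx R q c b.
Proof.
apply/matrixP => i j; rewrite -[in RHS](trmxK (_ *m slice_mx R q c b)) trmx_mul [RHS]mxE.
rewrite tr_slice_mx_mulE mxE /mxget andbC; case: (c <= j)%N => //=.
case: (insub (j - c)%N) => [l|]; last by case: ifP => //; case: (insub _).
by rewrite valK mxE tr_slice_mx_mulE /mxget valK.
Qed.

Lemma bform_place p q r c a b (M : 'M[R]_(a, b)) u v :
  bform (place p q r c M) u v = bform M (slice r a u) (slice c b v).
Proof. by rewrite place_slice_mx bform_mulmx. Qed.

Lemma slice_place p q r c a b (M : 'M[R]_(a, b)) (v : 'cV[R]_q) : (r + a <= p)%N ->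
  slice r a (place p q r c M *m v) = M *m slice c b v.
Proof.
by move=> rap; rewrite place_slice_mx /slice !mulmxA slice_mx_mul_tr // mul1mx.
Qed.

Lemma place0_mulmx p q c b (M : 'M[R]_(p, b)) (v : 'cV[R]_q) :
  place p q 0 c M *m v = M *m slice c b v.
Proof. by rewrite -[LHS]slice_id slice_place. Qed.

Lemma slice_place_disjoint p q r c a b (M : 'M[R]_(a, b)) s d (v : 'cV[R]_q) :
  (s + d <= r)%N || (r + a <= s)%N -> slice s d (place p q r c M *m v) = 0.
Proof.
by move=> disj; rewrite place_slice_mx /slice !mulmxA slice_mx_mul_tr0 // !mul0mx.
Qed.

(* Rows past the blocks of s are zero; blocks that do not fit in q rows are cut. *)
Definition stack q n (s : seq 'cV[R]_n) : 'cV[R]_q :=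
  \sum_(b < size s) (slice_mx R q (b * n) n)^T *m s`_b.

Lemma slice_stack q n (s : seq 'cV[R]_n) b r : r = (b * n)%N -> (r + n <= q)%N ->
  slice r n (stack q s) = s`_b.
Proof.
move=> -> bq; rewrite /slice /stack mulmx_sumr.
have off_block (j : 'I_(size s)) : j != b :> nat ->
    slice_mx R q (b * n) n *m ((slice_mx R q (j * n) n)^T *m s`_j) = 0.
  by move=> jb; rewrite mulmxA slice_mx_mul_tr0 ?mul0mx // -!mulSnr !leq_mul2r; lia.
have [b_s|s_b] := ltnP b (size s); last first.
  by rewrite nth_default // big1 // => j _; apply: off_block; have := ltn_ord j; lia.
by rewrite (bigD1 (Ordinal b_s)) //= mulmxA slice_mx_mul_tr // mul1mx big1 ?addr0.
Qed.

Lemma eq_stack K q n (v : 'cV[R]_q) (s : seq 'cV[R]_n) : q = (K * n)%N ->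
  (forall b, (b < K)%N -> slice (b * n) n v = s`_b) -> v = stack q s.
Proof.
move=> qE vs; apply: slice_inj => i i_q; have i_Kn : (i < K * n)%N by rewrite -qE.
have n0 : (0 < n)%N by move: i_Kn; case: (n); rewrite ?muln0.
have iK : (i %/ n < K)%N by rewrite ltn_divLR.
exists (i %/ n * n)%N, n; split; first by rewrite leq_divM /= -mulSnr ltn_ceil.
by rewrite vs // (slice_stack s erefl) // qE -mulSnr leq_mul2r iK orbT.
Qed.

End Blocks.

(* On a sum of placed blocks: each block either fills the rows of the slice
   exactly or misses them. *)
Ltac slice_places :=
  rewrite ?(mul0n, mul1n) ?mulmxDl ?sliceD;
  repeat match goal with
  | |- context [slice ?s ?d (place ?p ?q ?r ?c ?M *m ?v)] =>
    first [ rewrite (@slice_place_disjoint _ p q r c _ _ M s d v); last lia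
          | rewrite (@slice_place _ p q r c _ _ M v); last lia ]
  end;
  rewrite ?(add0r, addr0).

Section ShiftedWindows.
Variables (V : zmodType) (f : nat -> V).

Lemma sum_window_succ a b : (a <= b)%N ->
  \sum_(a <= i < b) f i.+1 = \sum_(a <= i < b) f i + (f b - f a).
Proof.
move=> ab; rewrite -telescope_sumr // -big_split; apply: eq_bigr => i _ /=.
by rewrite addrC subrK.
Qed.

Lemma sum_double_window_succ a b L : (a <= b)%N -> (b <= L)%N ->
  \sum_(a <= j < b) \sum_(j <= i < L) f i.+1 =
  \sum_(a <= j < b) \sum_(j <= i < L) f i + (f L *+ (b - a) - \sum_(a <= j < b) f j).
Proof.
move=> ab bL; rewrite -sumr_const_nat -sumrB -big_split.
apply: eq_big_nat => j /andP[_ jb] /=; rewrite sum_window_succ //.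
exact: leq_trans (ltnW jb) bL.
Qed.

End ShiftedWindows.

Section Bessel.
Variables (R : realType) (n : nat) (M : 'M[R]_n) (I : Type) (r : seq I).
Implicit Types (e f : I -> R) (y : I -> 'cV[R]_n).

(* Pythagoras for y minus its projection on e; for e = 0 the coefficient N^-1 is 0. *)
Lemma sum_qform_residual e y : M^T = M ->
  let N := \sum_(i <- r) e i ^+ 2 in let s := \sum_(i <- r) e i *: y i in
  \sum_(i <- r) qform M (y i - e i *: (N^-1 *: s)) =
  \sum_(i <- r) qform M (y i) - N^-1 * qform M s.
Proof.
move=> sM N s; set a := N^-1 *: s.
transitivity (\sum_(i <- r) qform M (y i) - 2 * bform M s a + N * qform M a).
  rewrite linear_sumlz mulr_sumr mulr_suml -sumrB -big_split; apply: eq_bigr => i _ /=.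
  by rewrite qformB // qformZ linearZr_LR linearZl_LR.
rewrite /a linearZr_LR qformZ /= -/(qform M s).
have [->|N0] := eqVneq N 0; first by rewrite invr0; ring.
by field.
Qed.

Lemma bessel_pair e f y : posdef M -> \sum_(i <- r) e i * f i = 0 ->
  (\sum_(i <- r) e i ^+ 2)^-1 * qform M (\sum_(i <- r) e i *: y i)
  + (\sum_(i <- r) f i ^+ 2)^-1 * qform M (\sum_(i <- r) f i *: y i)
  <= \sum_(i <- r) qform M (y i).
Proof.
move=> pM ef0; have [sM _] := pM.
set s := \sum_(i <- r) e i *: y i; set N := \sum_(i <- r) e i ^+ 2.
pose y' i := y i - e i *: (N^-1 *: s).
have -> : \sum_(i <- r) f i *: y i = \sum_(i <- r) f i *: y' i.
  rewrite [RHS](eq_bigr (fun i => f i *: y i - (e i * f i) *: (N^-1 *: s))).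
    by rewrite sumrB -scaler_suml ef0 scale0r subr0.
  by move=> i _; rewrite scalerBr (scalerA (f i)) mulrC.
have residual_ge0 : 0 <= \sum_(i <- r) qform M (y' i - f i *:
    ((\sum_(i <- r) f i ^+ 2)^-1 *: \sum_(i <- r) f i *: y' i)).
  by apply: sumr_ge0 => i _; exact: posdef_ge0.
move: residual_ge0; rewrite !sum_qform_residual // -/N -/s; lra.
Qed.

End Bessel.

Section Wirtinger.
Variables (R : realType) (n : nat).
Implicit Types (M : 'M[R]_n) (z : nat -> 'cV[R]_n).

Definition mean a b z : 'cV[R]_n := ((b - a)%:R + 1)^-1 *: \sum_(a <= i < b.+1) z i.

Lemma mean_scale a b z : ((b - a)%:R + 1) *: mean a b z = \sum_(a <= i < b.+1) z i.
Proof. by rewrite scalerA mulfV ?scale1r // natr1 pnatr_eq0. Qed.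

Lemma mean_nat1 a z : mean a a z = z a.
Proof. by rewrite /mean big_nat1 subnn mulr0n add0r invr1 scale1r. Qed.

Lemma sum_odd_sub K (l : R) :
  \sum_(0 <= i < K) (2 * i%:R + 1 - l) = K%:R ^+ 2 - l * K%:R.
Proof.
elim: K => [|K IH]; first by rewrite big_geq //; ring.
by rewrite big_nat_recr //= IH -natr1; ring.
Qed.

Lemma sum_sqr_odd_sub K (l : R) :
  \sum_(0 <= i < K) (2 * i%:R + 1 - l) ^+ 2 =
  (4 * K%:R ^+ 3 - K%:R) / 3 - 2 * l * K%:R ^+ 2 + l ^+ 2 * K%:R.
Proof.
elim: K => [|K IH]; first by rewrite big_geq //; field.
by rewrite big_nat_recr //= IH -natr1; field.
Qed.

Lemma sum_odd_sub_diff K (l : R) z :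
  \sum_(0 <= i < K) (2 * i%:R + 1 - l) *: (z i.+1 - z i) =
  (2 * K%:R + 1 - l) *: z K + (l + 1) *: z 0%N - 2 *: \sum_(0 <= i < K.+1) z i.
Proof.
elim: K => [|K IH].
  by rewrite big_geq // big_nat1; apply/colP => i; rewrite !mxE; ring.
rewrite big_nat_recr //= IH [in RHS]big_nat_recr //=; set s := \sum_(_ <= _ < _) _.
by apply/colP => i; rewrite !mxE -natr1; ring.
Qed.

Lemma mean_gap_le1 L z : (L <= 1)%N -> z L + z 0%N - 2 *: mean 0 L z = 0.
Proof.
by rewrite /mean subn0; case: L => [|[|//]] _; rewrite !big_nat_recr // big_geq //=;
  apply/colP => i; rewrite !mxE; field.
Qed.

(* Bessel's inequality for the increments of z against the orthogonal
   sequences 1 and 2i + 1 - L. *)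
Lemma wirtinger_from0 M z L : posdef M -> (0 < L)%N ->
  qform M (z L - z 0%N) + 3 * gammad R L * qform M (z L + z 0%N - 2 *: mean 0 L z)
  <= L%:R * \sum_(0 <= i < L) qform M (z i.+1 - z i).
Proof.
move=> pM L_gt0; have [L_le1|L_gt1] := leqP L 1.
  have -> : L = 1%N by lia.
  by rewrite mean_gap_le1 // qform0 big_nat1 mulr0 addr0 mul1r.
pose l : R := L%:R; have l_gt1 : 1 < l by rewrite ltr1n.
have -> : gammad R L = (l + 1) / (l - 1) by rewrite /gammad; case: eqP => //; lia.
set G := z L + _ - _.
have := @bessel_pair _ _ M _ (index_iota 0 L) (fun=> 1) (fun i => 2 * i%:R + 1 - l)
  (fun i => z i.+1 - z i) pM.
have sum_one : \sum_(i <- index_iota 0 L) 1 ^+ 2 = l.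
  by rewrite (eq_bigr (fun=> 1)) ?sumr_const_nat ?subn0 // => i _; rewrite expr1n.
have sum_weights : \sum_(i <- index_iota 0 L) 1 * (2 * i%:R + 1 - l) = 0.
  by rewrite -mulr_sumr sum_odd_sub -/l; ring.
have sum_incr : \sum_(i <- index_iota 0 L) 1 *: (z i.+1 - z i) = z L - z 0%N.
  by rewrite -scaler_sumr scale1r telescope_sumr.
have sum_weighted_incr :
    \sum_(i <- index_iota 0 L) (2 * i%:R + 1 - l) *: (z i.+1 - z i) = (l + 1) *: G.
  rewrite sum_odd_sub_diff -mean_scale subn0 -/l /G.
  by apply/colP => i; rewrite !mxE; ring.
rewrite sum_one sum_incr sum_weighted_incr sum_sqr_odd_sub -/l qformZ => /(_ sum_weights).
rewrite -(ler_pM2l (_ : 0 < l)); last lra.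
apply: le_trans; rewrite le_eqVlt; apply/orP; left; apply/eqP.
by field; rewrite !gt_eqF //; nra.
Qed.

Lemma wirtinger M z a b : posdef M -> (a < b)%N ->
  qform M (z b - z a) + 3 * gammad R (b - a) * qform M (z b + z a - 2 *: mean a b z)
  <= (b - a)%:R * \sum_(a <= i < b) qform M (z i.+1 - z i).
Proof.
move=> pM ab; have le_ab := ltnW ab.
have shift (V : zmodType) (F : nat -> V) c :
    \sum_(a <= i < c) F i = \sum_(0 <= i < c - a) F (i + a)%N.
  by rewrite -{1}(add0n a) big_addn.
have := wirtinger_from0 (fun i => z (i + a)%N) pM (_ : 0 < b - a)%N.
by rewrite /mean !shift subSn // subn0 add0n subnK //; apply; rewrite subn_gt0.
Qed.

Lemma gammad_ge1 L : (0 < L)%N -> (1 : R) <= gammad R L.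
Proof.
rewrite /gammad; case: eqP => // L1 L0; have l_gt1 : (1 : R) < L%:R by rewrite ltr1n; lia.
by rewrite ler_pdivlMr; lra.
Qed.

Lemma wirtinger_weak M z a b : posdef M -> (a <= b)%N ->
  qform M (z b - z a) + 3 * qform M (z b + z a - 2 *: mean a b z)
  <= (b - a)%:R * \sum_(a <= i < b) qform M (z i.+1 - z i).
Proof.
move=> pM; rewrite leq_eqVlt => /predU1P[->|ab].
  by rewrite mean_nat1 scaler_nat mulr2n !subrr qform0 mulr0 addr0 subnn mul0r.
apply: le_trans (wirtinger z pM ab); rewrite lerD2l -mulrA ler_pM2l //.
by rewrite ler_peMl ?posdef_ge0 // gammad_ge1 // subn_gt0.
Qed.

End Wirtinger.

Section DelayMatrices.
Variables (R : realType) (n dm dM : nat).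
Implicit Types (P : 'M[R]_(3 * n)) (W Z : 'M[R]_n) (X : 'M[R]_(2 * n)).
Implicit Types (xi : 'cV[R]_(8 * n)).
Local Notation part b := (slice (b * n) n).

Lemma Mmat_mulmx (v : 'cV[R]_(6 * n)) :
  Mmat R n *m v =
  stack _ [:: part 1 v - part 2 v; part 1 v + part 2 v - 2 *: part 5 v].
Proof.
apply: (@eq_stack _ 2) => // -[|[|//]] _; rewrite /Mmat; slice_places;
  by rewrite /sI !mul_scalar_mx ?scale1r ?scaleN1r ?scaleNr.
Qed.

Lemma Mmat_mulmx_slice b xi : (b < 3)%N ->
  Mmat R n *m slice (b * n) (6 * n) xi =
  stack _ [:: part (b + 1) xi - part (b + 2) xi;
    part (b + 1) xi + part (b + 2) xi - 2 *: part (b + 5) xi].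
Proof.
move=> b3; have bn : (b * n <= 2 * n)%N by rewrite leq_mul2r -ltnS b3 orbT.
by rewrite Mmat_mulmx !slice_slice -?mulnDl //; lia.
Qed.

Lemma FPsi_mulmx xi :
  FPsi R n *m xi =
  stack _ [::
    stack (2 * n) [:: part 3 xi - part 4 xi; part 3 xi + part 4 xi - 2 *: part 7 xi];
    stack (2 * n) [:: part 2 xi - part 3 xi; part 2 xi + part 3 xi - 2 *: part 6 xi]].
Proof.
have := Mmat_mulmx_slice xi (isT : 2 < 3)%N; have := Mmat_mulmx_slice xi (isT : 1 < 3)%N.
rewrite mul1n /FPsi; move: (Mmat R n) => M <- <-.
by apply: (@eq_stack _ 2) => [|[|[|//]] _]; [lia | slice_places..].
Qed.

Lemma Fsm_mulmx xi :
  Fsm R n *m xi =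
  stack _ [:: part 1 xi - part 2 xi; part 1 xi + part 2 xi - 2 *: part 5 xi].
Proof. by rewrite /Fsm place0_mulmx (Mmat_mulmx_slice (b := 0)). Qed.

Lemma F3_mulmx xi : F3 R n *m xi = part 0 xi - part 1 xi.
Proof.
by rewrite /F3 mulmxDl !place0_mulmx /sI !mul_scalar_mx scale1r scaleN1r mul0n mul1n.
Qed.

Lemma F1_Fd_mulmx d xi :
  (F1 R n dm dM + Fd R n d) *m xi =
  stack _ [:: part 1 xi; (dm%:R + 1) *: part 5 xi - part 1 xi;
    (d%:R - dm%:R + 1) *: part 6 xi + (dM%:R - d%:R + 1) *: part 7 xi
    - part 2 xi - part 3 xi].
Proof.
apply: (@eq_stack _ 3) => // -[|[|[|//]]] _; rewrite /F1 /Fd; slice_places;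
  by rewrite /sI !mul_scalar_mx /=; apply/colP => i; rewrite !mxE; ring.
Qed.

Lemma F2_Fd_mulmx d xi :
  (F2 R n dm dM + Fd R n d) *m xi =
  stack _ [:: part 0 xi; (dm%:R + 1) *: part 5 xi - part 2 xi;
    (d%:R - dm%:R + 1) *: part 6 xi + (dM%:R - d%:R + 1) *: part 7 xi
    - part 3 xi - part 4 xi].
Proof.
apply: (@eq_stack _ 3) => // -[|[|[|//]]] _; rewrite /F2 /Fd; slice_places;
  by rewrite /sI !mul_scalar_mx /=; apply/colP => i; rewrite !mxE; ring.
Qed.

Lemma qform_place_diag (Z Z' : 'M[R]_n) u v :
  qform (place (2 * n) (2 * n) 0 0 Z + place (2 * n) (2 * n) n n Z') (stack _ [:: u; v]) =
  qform Z u + qform Z' v.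
Proof.
rewrite /qform bformD !bform_place.
by rewrite (@slice_stack _ _ _ _ 0 0) ?(@slice_stack _ _ _ _ 1 n) //; lia.
Qed.

Lemma qform_scrZ1 Z u v :
  qform (scrZ1 dm Z) (stack _ [:: u; v]) = qform Z u + 3 * gammad R dm * qform Z v.
Proof. by rewrite qform_place_diag /qform bformZ. Qed.

Lemma qform_scrZ2 Z u v :
  qform (scrZ2 Z) (stack _ [:: u; v]) = qform Z u + 3 * qform Z v.
Proof. by rewrite qform_place_diag /qform bformZ. Qed.

Lemma bform_Psiz Z X u v u' v' :
  bform (Psiz Z X) (stack _ [:: u; v]) (stack _ [:: u'; v']) =
  bform (scrZ2 Z) u u' + bform X u v' + bform X u' v + bform (scrZ2 Z) v v'.
Proof.
rewrite /Psiz; move: (scrZ2 Z) => T; rewrite !bformD !bform_place bform_tr.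
by rewrite !(@slice_stack _ _ _ _ 0 0) ?(@slice_stack _ _ _ _ 1 (2 * n)) //; lia.
Qed.

Lemma qform_Wmat W1 W2 xi :
  qform (Wmat W1 W2) xi =
  (qform W1 (part 1 xi) - qform W1 (part 2 xi))
  + (qform W2 (part 2 xi) - qform W2 (part 4 xi)).
Proof. by rewrite /qform /Wmat !bformD !bform_place !(bformD, bformN) !mul1n; ring. Qed.

Lemma qform_Phi P W1 W2 Z1 Z2 X d xi : P^T = P ->
  qform (Phi dm dM P W1 W2 Z1 Z2 X d) xi =
    qform P ((F2 R n dm dM + Fd R n d) *m xi) - qform P ((F1 R n dm dM + Fd R n d) *m xi)
  + qform (Wmat W1 W2) xi
  + (dm%:R ^+ 2 * qform Z1 (F3 R n *m xi) + (dM - dm)%:R ^+ 2 * qform Z2 (F3 R n *m xi))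
  - qform (scrZ1 dm Z1) (Fsm R n *m xi) - qform (Psiz Z2 X) (FPsi R n *m xi).
Proof.
move=> sP; rewrite /Phi.
move: (scrZ1 dm Z1) (Psiz Z2 X) (Wmat W1 W2) (F1 _ _ _ _) (F2 _ _ _ _) (Fd _ _ _) (F3 _ _).
move=> T Psi W G1 G2 G G3; rewrite /qform /He !(bformD, bformN) bform_tr.
rewrite !bform_mulmx bformD !bformZ mulmxBl !mulmxDl.
move: (G1 *m xi) (G2 *m xi) (G *m xi) => g1 g2 g.
rewrite !(linearDl, linearDr, linearNr) /= (bformC g g1 sP) (bformC g g2 sP).
ring.
Qed.

Lemma Phi_affine P W1 W2 Z1 Z2 X d :
  Phi dm dM P W1 W2 Z1 Z2 X d =
  Phi dm dM P W1 W2 Z1 Z2 X 0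
  + d%:R *: He ((Fd R n 1)^T *m P *m (F2 R n dm dM - F1 R n dm dM)).
Proof.
have FdE e : Fd R n e = e%:R *: Fd R n 1.
  rewrite /Fd !place_slice_mx /sI !mul_mx_scalar -!scalemxAl scalerDr !scalerA.
  by congr (_ *: _ + _ *: _); ring.
have HeZ (k : R) (Y : 'M[R]_(8 * n)) : He (k *: Y) = k *: He Y.
  by rewrite /He linearZ scalerDr.
rewrite /Phi (FdE d) (FdE 0%N) !linearZ /= -!scalemxAl !HeZ scale0r addr0.
by set H := d%:R *: _; rewrite !(addrAC _ _ H).
Qed.

Lemma qform_Phi_interp P W1 W2 Z1 Z2 X xi e d : (dm <= d <= dM)%N ->
  qform (Phi dm dM P W1 W2 Z1 Z2 X dm) xi <= e ->
  qform (Phi dm dM P W1 W2 Z1 Z2 X dM) xi <= e ->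
  qform (Phi dm dM P W1 W2 Z1 Z2 X d) xi <= e.
Proof.
rewrite -!(ler_nat R) (Phi_affine _ _ _ _ _ _ d) (Phi_affine _ _ _ _ _ _ dm).
rewrite (Phi_affine _ _ _ _ _ _ dM) /qform => /andP[].
move: (Phi _ _ _ _ _ _ _ _ 0) (He _) => E H; rewrite !bformD !bformZ.
by have [H_ge0|H_lt0] := leP 0 (bform H xi xi); nra.
Qed.

End DelayMatrices.

Section ReciprocallyConvex.
Variable R : realType.

(* By AM-GM, 2 x <= 2 sqrt (l1 s2 * l2 s1) <= l1 s2 + l2 s1. *)
Lemma reciprocally_convex (q1 q2 x l1 l2 s1 s2 : R) :
  0 <= q1 -> 0 <= q2 -> x ^+ 2 <= q1 * q2 ->
  0 <= l1 -> 0 <= l2 -> 0 <= s1 -> 0 <= s2 -> q1 <= l1 * s1 -> q2 <= l2 * s2 ->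
  q1 + 2 * x + q2 <= (l1 + l2) * (s1 + s2).
Proof.
move=> q1_ge0 q2_ge0 x_le l1_ge0 l2_ge0 s1_ge0 s2_ge0 q1_le q2_le.
have cross_ge0 : 0 <= l1 * s2 + l2 * s1 by rewrite addr_ge0 ?mulr_ge0.
have x_sqr_le : x ^+ 2 <= (l1 * s1) * (l2 * s2).
  by apply: le_trans x_le _; exact: ler_pM.
have amgm : (2 * x) ^+ 2 <= (l1 * s2 + l2 * s1) ^+ 2.
  by have := sqr_ge0 (l1 * s2 - l2 * s1); lra.
have : 2 * x <= l1 * s2 + l2 * s1.
  have [x_lt0|x_ge0] := ltP x 0; first lra.
  by rewrite -ler_sqr // nnegrE mulr_ge0.
lra.
Qed.

Variables (n : nat) (Z : 'M[R]_n) (X : 'M[R]_(2 * n)).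
Hypothesis pPsi : posdef (Psiz Z X).
Implicit Types u v : 'cV[R]_(2 * n).

Lemma scrZ2_ge0 u : 0 <= qform (scrZ2 Z) u.
Proof.
have := posdef_ge0 (stack _ [:: u; 0]) pPsi.
by rewrite /qform bform_Psiz !(linear0l, linear0r) !addr0.
Qed.

Lemma Psiz_cauchy u v :
  bform X u v ^+ 2 <= qform (scrZ2 Z) u * qform (scrZ2 Z) v.
Proof.
have := posdef_cauchy (stack _ [:: u; 0]) (stack _ [:: 0; v]) pPsi.
by rewrite /qform !bform_Psiz !(linear0l, linear0r) !(add0r, addr0).
Qed.

Lemma qform_Psiz_le u v (l1 l2 s1 s2 : R) :
  0 <= l1 -> 0 <= l2 -> 0 <= s1 -> 0 <= s2 ->
  qform (scrZ2 Z) u <= l1 * s1 -> qform (scrZ2 Z) v <= l2 * s2 ->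
  qform (Psiz Z X) (stack _ [:: u; v]) <= (l1 + l2) * (s1 + s2).
Proof.
move=> l1_ge0 l2_ge0 s1_ge0 s2_ge0 u_le v_le; rewrite {1}/qform bform_Psiz.
have := reciprocally_convex (scrZ2_ge0 u) (scrZ2_ge0 v) (Psiz_cauchy u v)
  l1_ge0 l2_ge0 s1_ge0 s2_ge0 u_le v_le.
by rewrite /qform; lra.
Qed.

End ReciprocallyConvex.

Section LyapunovKrasovskii.
Variables (R : realType) (n dm dM : nat).
Variables (P : 'M[R]_(3 * n)) (W1 W2 Z1 Z2 : 'M[R]_n).
Hypothesis dm_le_dM : (dm <= dM)%N.

(* h i stands for x(k - dM + i): the current state is h dM, the state delayed
   by d is h (dM - d), and the next state is h dM.+1. *)
Implicit Types h : nat -> 'cV[R]_n.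

Definition history h : seq 'cV[R]_n :=
  [:: h dM; \sum_(dM - dm <= i < dM) h i; \sum_(0 <= i < dM - dm) h i].

Definition incr (Z : 'M[R]_n) h i : R := qform Z (h i.+1 - h i).

Definition lkf h : R :=
  qform P (stack _ (history h))
  + \sum_(dM - dm <= i < dM) qform W1 (h i)
  + \sum_(0 <= i < dM - dm) qform W2 (h i)
  + dm%:R * \sum_(dM - dm <= j < dM) \sum_(j <= i < dM) incr Z1 h i
  + (dM - dm)%:R * \sum_(0 <= j < dM - dm) \sum_(j <= i < dM) incr Z2 h i.

Definition lags d h : seq 'cV[R]_n :=
  [:: h dM.+1; h dM; h (dM - dm)%N; h (dM - d)%N; h 0%N;
      mean (dM - dm) dM h; mean (dM - d) (dM - dm) h; mean 0 (dM - d) h].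

Lemma incr_ge0 Z h i : posdef Z -> 0 <= incr Z h i.
Proof. exact: posdef_ge0. Qed.

Lemma lkf_ge h : posdef W1 -> posdef W2 -> posdef Z1 -> posdef Z2 ->
  qform P (stack _ (history h)) <= lkf h.
Proof.
move=> pW1 pW2 pZ1 pZ2; have window_ge0 (W : 'M[R]_n) a b : posdef W ->
    0 <= \sum_(a <= i < b) qform W (h i).
  by move=> pW; apply: sumr_ge0 => i _; exact: posdef_ge0.
have double_window_ge0 (Z : 'M[R]_n) a b : posdef Z ->
    0 <= \sum_(a <= j < b) \sum_(j <= i < dM) incr Z h i.
  by move=> pZ; apply: sumr_ge0 => j _; apply: sumr_ge0 => i _; exact: incr_ge0.
by rewrite /lkf -!addrA lerDl !addr_ge0 ?mulr_ge0 ?window_ge0 ?double_window_ge0.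
Qed.

Section DelayedState.
Variables (X : 'M[R]_(2 * n)) (h : nat -> 'cV[R]_n) (d : nat).
Hypothesis d_bounds : (dm <= d <= dM)%N.
Local Notation xi := (stack (8 * n) (lags d h)).

Lemma slice_lags b : (b < 8)%N -> slice (b * n) n xi = (lags d h)`_b.
Proof. by move=> b8; rewrite (slice_stack _ (erefl _)) // -mulSnr leq_mul2r b8 orbT. Qed.

Lemma scale_mean_recent :
  (dm%:R + 1) *: mean (dM - dm) dM h = \sum_(dM - dm <= i < dM.+1) h i.
Proof. by rewrite -{1}(subKn dm_le_dM) mean_scale. Qed.

Lemma scale_means_delayed :
  (d%:R - dm%:R + 1) *: mean (dM - d) (dM - dm) h + (dM%:R - d%:R + 1) *: mean 0 (dM - d) h
  = \sum_(dM - d <= i < (dM - dm).+1) h i + \sum_(0 <= i < (dM - d).+1) h i.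
Proof.
have /andP[dm_d d_dM] := d_bounds; rewrite -!natrB //.
have -> : (d - dm = (dM - dm) - (dM - d))%N by lia.
by rewrite mean_scale -(mean_scale 0) subn0.
Qed.

Lemma F1_Fd_lags : (F1 R n dm dM + Fd R n d) *m xi = stack _ (history h).
Proof.
have /andP[dm_d d_dM] := d_bounds.
rewrite F1_Fd_mulmx !slice_lags //= scale_mean_recent scale_means_delayed /history.
rewrite !big_nat_recr ?leq_sub2l ?leq_subr //= addrK; congr (stack _ [:: _; _; _]).
rewrite [RHS](@big_cat_nat _ _ _ (dM - d)%N) ?leq_sub2l //=.
by apply/colP => i; rewrite !mxE; ring.
Qed.

Lemma F2_Fd_lags : (F2 R n dm dM + Fd R n d) *m xi = stack _ (history (h \o succn)).
Proof.
have /andP[dm_d d_dM] := d_bounds.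
rewrite F2_Fd_mulmx !slice_lags //= scale_mean_recent scale_means_delayed /history.
rewrite !big_nat_recl ?leq_sub2l ?leq_subr //= addrC addKr; congr (stack _ [:: _; _; _]).
rewrite [RHS](@big_cat_nat _ _ _ (dM - d)%N) ?leq_sub2l //=.
by apply/colP => i; rewrite !mxE; ring.
Qed.

Lemma qform_scrZ1_Fsm_le : posdef Z1 -> (0 < dm)%N ->
  qform (scrZ1 dm Z1) (Fsm R n *m xi)
  <= dm%:R * \sum_(dM - dm <= i < dM) incr Z1 h i.
Proof.
move=> pZ1 dm_gt0; rewrite Fsm_mulmx !slice_lags //= qform_scrZ1.
have := wirtinger h pZ1 (_ : dM - dm < dM)%N; rewrite subKn //; apply; lia.
Qed.

Lemma qform_Psiz_FPsi_le : posdef Z2 -> posdef (Psiz Z2 X) ->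
  qform (Psiz Z2 X) (FPsi R n *m xi)
  <= (dM - dm)%:R * \sum_(0 <= i < dM - dm) incr Z2 h i.
Proof.
move=> pZ2 pPsi; have /andP[dm_d d_dM] := d_bounds.
have le_window : (dM - d <= dM - dm)%N by exact: leq_sub2l.
rewrite FPsi_mulmx !slice_lags //= (@big_cat_nat _ _ _ (dM - d)%N) //=.
have -> : (dM - dm)%:R = (dM - d - 0)%:R + (dM - dm - (dM - d))%:R :> R.
  by rewrite -natrD subn0 subnKC.
have sum_incr_ge0 a b : 0 <= \sum_(a <= i < b) incr Z2 h i.
  by apply: sumr_ge0 => i _; exact: incr_ge0.
by apply: qform_Psiz_le => //; rewrite qform_scrZ2; exact: wirtinger_weak.
Qed.

Lemma lkf_succ :
  lkf (h \o succn) - lkf h =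
  qform P (stack _ (history (h \o succn))) - qform P (stack _ (history h))
  + (qform W1 (h dM) - qform W1 (h (dM - dm)%N))
  + (qform W2 (h (dM - dm)%N) - qform W2 (h 0%N))
  + dm%:R * (dm%:R * incr Z1 h dM - \sum_(dM - dm <= i < dM) incr Z1 h i)
  + (dM - dm)%:R * ((dM - dm)%:R * incr Z2 h dM - \sum_(0 <= i < dM - dm) incr Z2 h i).
Proof.
have le_dM : (dM - dm <= dM)%N := leq_subr _ _.
rewrite /lkf (sum_window_succ (fun i => qform W1 (h i))) //.
rewrite (sum_window_succ (fun i => qform W2 (h i))) //.
rewrite (sum_double_window_succ (incr Z1 h)) // (sum_double_window_succ (incr Z2 h)) //.
rewrite subKn // subn0 -!(mulr_natl (incr _ _ _)).
ring.
Qed.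

Lemma lkf_decrease :
  (0 < dm)%N -> P^T = P -> posdef Z1 -> posdef Z2 -> posdef (Psiz Z2 X) ->
  lkf (h \o succn) - lkf h <= qform (Phi dm dM P W1 W2 Z1 Z2 X d) xi.
Proof.
move=> dm_gt0 sP pZ1 pZ2 pPsi.
have := qform_scrZ1_Fsm_le pZ1 dm_gt0; have := qform_Psiz_FPsi_le pZ2 pPsi.
rewrite lkf_succ qform_Phi // F1_Fd_lags F2_Fd_lags qform_Wmat F3_mulmx !slice_lags //=.
rewrite /incr; lra.
Qed.

End DelayedState.
End LyapunovKrasovskii.

Section Domination.
Variables (R : realType) (T : Type) (g : T -> R).
Implicit Types (f : T -> R).

Definition dominated f : Prop := exists2 c : R, 0 <= c & forall t, f t <= c * g t.

Lemma dominatedD f1 f2 : dominated f1 -> dominated f2 ->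
  dominated (fun t => f1 t + f2 t).
Proof.
move=> [c1 c1_ge0 f1_le] [c2 c2_ge0 f2_le].
by exists (c1 + c2) => [|t]; [exact: addr_ge0 | rewrite mulrDl lerD].
Qed.

Lemma dominatedZ k f : 0 <= k -> dominated f -> dominated (fun t => k * f t).
Proof.
move=> k_ge0 [c c_ge0 f_le].
by exists (k * c) => [|t]; [exact: mulr_ge0 | rewrite -mulrA ler_wpM2l].
Qed.

Lemma dominated_le f1 f2 : (forall t, f1 t <= f2 t) -> dominated f2 -> dominated f1.
Proof. by move=> f12 [c c_ge0 f2_le]; exists c => // t; exact: le_trans (f2_le t). Qed.

Lemma dominated_sum (I : eqType) (r : seq I) (f : I -> T -> R) :
  (forall i, i \in r -> dominated (f i)) -> dominated (fun t => \sum_(i <- r) f i t).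
Proof.
move=> f_dom; rewrite -fct_sumE big_seq; apply: big_ind => //; last exact: dominatedD.
by exists 0 => // t; rewrite mul0r.
Qed.

Lemma dominated_qform n (M : 'M[R]_n) (F : T -> 'cV[R]_n) :
  dominated (fun t => normsq (F t)) -> dominated (fun t => qform M (F t)).
Proof.
have [c c_ge0 M_le] := qform_le_normsq M.
by move=> /(dominatedZ c_ge0); apply: dominated_le.
Qed.

Lemma dominated_normsq_mulmx m n (M : 'M[R]_(m, n)) (F : T -> 'cV[R]_n) :
  dominated (fun t => normsq (F t)) -> dominated (fun t => normsq (M *m F t)).
Proof.
move=> /(dominated_qform (M^T *m M)); apply: dominated_le => t.
by rewrite normsq_mulmx.
Qed.

Lemma dominated_normsqD n (F G : T -> 'cV[R]_n) :
  dominated (fun t => normsq (F t)) -> dominated (fun t => normsq (G t)) ->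
  dominated (fun t => normsq (F t + G t)).
Proof.
move=> F_dom G_dom; have := dominatedZ (ler0n R 2) (dominatedD F_dom G_dom).
by apply: dominated_le => t; exact: normsqD_le.
Qed.

Lemma dominated_normsqB n (F G : T -> 'cV[R]_n) :
  dominated (fun t => normsq (F t)) -> dominated (fun t => normsq (G t)) ->
  dominated (fun t => normsq (F t - G t)).
Proof.
move=> F_dom /(dominated_normsq_mulmx (- 1%:M)) G_dom.
apply: dominated_le (dominated_normsqD F_dom G_dom) => t.
by rewrite mulNmx mul1mx.
Qed.

Lemma dominated_normsq_sum n (I : eqType) (r : seq I) (F : I -> T -> 'cV[R]_n) :
  (forall i, i \in r -> dominated (fun t => normsq (F i t))) ->
  dominated (fun t => normsq (\sum_(i <- r) F i t)).
Proof.
move=> F_dom; rewrite -[X in dominated X]/(@normsq R n \o _) -fct_sumE big_seq.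
apply: (big_ind (fun G => dominated (@normsq R n \o G))) => //.
- by exists 0 => // t; rewrite mul0r /= normsqE qform0.
- by move=> F1 F2; exact: dominated_normsqD.
Qed.

Lemma dominated_normsq_stack q n K (F : T -> seq 'cV[R]_n) :
  (forall t, size (F t) = K) ->
  (forall b, (b < K)%N -> dominated (fun t => normsq (F t)`_b)) ->
  dominated (fun t => normsq (stack q (F t))).
Proof.
move=> size_F F_dom.
apply: (@dominated_le _ (fun t =>
  normsq (\sum_(b < K) (slice_mx R q (b * n) n)^T *m (F t)`_b))) => [t|].
  by rewrite /stack size_F.
by apply: dominated_normsq_sum => b _; apply/dominated_normsq_mulmx/F_dom.
Qed.

End Domination.

Section LkfBounds.
Variables (R : realType) (n dm dM : nat).
Variables (P : 'M[R]_(3 * n)) (W1 W2 Z1 Z2 : 'M[R]_n).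

Definition segment_normsq (h : nat -> 'cV[R]_n) : R :=
  \big[Num.max/0]_(i < dM.+1) normsq (h i).

Lemma dominated_segment i : (i <= dM)%N ->
  dominated segment_normsq (fun h => normsq (h i)).
Proof.
rewrite -ltnS => i_dM; exists 1 => // h; rewrite mul1r.
exact: (le_bigmax _ _ (Ordinal i_dM)).
Qed.

Lemma dominated_history :
  dominated segment_normsq (fun h => normsq (stack (3 * n) (history dm dM h))).
Proof.
have sum_dom a b : (b <= dM)%N ->
    dominated segment_normsq (fun h => normsq (\sum_(a <= i < b) h i)).
  move=> b_dM; apply: dominated_normsq_sum => i; rewrite mem_index_iota => i_ab.
  by apply: dominated_segment; lia.
apply: (@dominated_normsq_stack _ _ _ _ _ 3) => // -[|[|[|//]]] _ /=.
- exact: dominated_segment.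
- exact: sum_dom.
- by apply: sum_dom; exact: leq_subr.
Qed.

Lemma dominated_window M a b : (b <= dM)%N ->
  dominated segment_normsq (fun h => \sum_(a <= i < b) qform M (h i)).
Proof.
move=> b_dM; apply: dominated_sum => i; rewrite mem_index_iota => i_ab.
by apply/dominated_qform/dominated_segment; lia.
Qed.

Lemma dominated_double_window M a b : (b <= dM)%N ->
  dominated segment_normsq
    (fun h => \sum_(a <= j < b) \sum_(j <= i < dM) incr M h i).
Proof.
move=> b_dM; apply: dominated_sum => j _; apply: dominated_sum => i.
rewrite mem_index_iota => /andP[_ i_dM].
by apply/dominated_qform/dominated_normsqB; apply: dominated_segment; lia.
Qed.

Lemma dominated_lkf : dominated segment_normsq (lkf dm dM P W1 W2 Z1 Z2).
Proof.
have le_dM : (dM - dm <= dM)%N := leq_subr _ _.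
rewrite /lkf; repeat apply: dominatedD.
- exact/dominated_qform/dominated_history.
- exact: dominated_window.
- exact: dominated_window.
- by apply: dominatedZ => //; exact: dominated_double_window.
- by apply: dominatedZ => //; exact: dominated_double_window.
Qed.

Lemma lkf_coercive :
  posdef P -> posdef W1 -> posdef W2 -> posdef Z1 -> posdef Z2 ->
  exists2 c : R, 0 < c & forall h, c * normsq (h dM) <= lkf dm dM P W1 W2 Z1 Z2 h.
Proof.
move=> pP pW1 pW2 pZ1 pZ2.
have [c c0 P_coer] := posdef_coercive_mulmx (slice_mx R (3 * n) 0 n) pP.
exists c => // h; apply: le_trans (lkf_ge dm dM P h pW1 pW2 pZ1 pZ2).
have := P_coer (stack _ (history dm dM h)).
by rewrite -/(slice 0 n _) (@slice_stack _ _ _ _ 0) //; lia.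
Qed.

End LkfBounds.

Section Dissipation.
Variables (R : realType) (V a : nat -> R) (c : R).
Hypotheses (c_gt0 : 0 < c) (a_ge0 : forall k, 0 <= a k).
Hypothesis V_decrease : forall k, V k.+1 - V k <= - (c * a k).

Lemma dissipation_nonincreasing i j : (i <= j)%N -> V j <= V i.
Proof.
apply: (@Order.NatMonotonyTheory.nonincnP _ _ V) => k.
by have := V_decrease k; have := mulr_ge0 (ltW c_gt0) (a_ge0 k); lra.
Qed.

Lemma dissipation_cvg0 : (forall k, 0 <= V k) ->
  forall eps, 0 < eps -> exists N, forall k, (N <= k)%N -> a k < eps.
Proof.
move=> V_ge0 eps eps_gt0.
have inf_V : has_inf (range V) by split; [exists (V 0%N), 0%N | exists 0 => _ [k _ <-]].
have [_ [N _ <-] VN_lt] := inf_adherent (mulr_gt0 c_gt0 eps_gt0) inf_V.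
exists N => k N_k; rewrite -(ltr_pM2l c_gt0).
have inf_le : inf (range V) <= V k.+1 by apply: ge_inf; [case: inf_V | exists k.+1].
have := V_decrease k; have := dissipation_nonincreasing N_k; lra.
Qed.

End Dissipation.

Section KrasovskiiStability.
Variables (R : realType) (n m p dM : nat).
Variables (A : 'M[R]_n) (B : 'M[R]_(n, m)) (K : 'M[R]_(m, p)) (C : 'M[R]_(p, n)).
Variables (d : nat -> nat) (V : (nat -> 'cV[R]_n) -> R) (a c : R).
Hypotheses (d_le_dM : forall k, (d k <= dM)%N) (a_gt0 : 0 < a) (c_gt0 : 0 < c).
Hypothesis V_coercive : forall h, a * normsq (h dM) <= V h.
Hypothesis V_dominated : dominated (segment_normsq dM) V.
Hypothesis V_decrease : forall k h,
  h dM.+1 = A *m h dM + B *m K *m C *m h (dM - d k)%N ->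
  V (h \o succn) - V h <= - (c * normsq (h dM)).

Definition segment (x : int -> 'cV[R]_n) (k : nat) : nat -> 'cV[R]_n :=
  fun i => x (Posz (k + i) - Posz dM).

Lemma segmentS x k : segment x k.+1 = segment x k \o succn.
Proof. by apply/funext => i; rewrite /segment /= addnS. Qed.

Lemma segment_last x k : segment x k dM = x (Posz k).
Proof. by rewrite /segment; congr x; lia. Qed.

Lemma decrease_along_solution x : closed_loop_sol A B K C d x ->
  forall k, V (segment x k.+1) - V (segment x k) <= - (c * normsq (x (Posz k))).
Proof.
move=> sol k; rewrite segmentS -segment_last; apply: (V_decrease (k := k)).
rewrite -[LHS]/((segment x k \o succn) dM) -segmentS !segment_last sol /segment.
by congr (_ + _ *m x _); have := d_le_dM k; lia.
Qed.

Lemma krasovskii_asymp_stable : asymp_stable A B K C dM d.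
Proof.
have x_ge0 (x : int -> 'cV[R]_n) k : 0 <= normsq (x (Posz k)) := normsq_ge0 _.
split=> [eps eps_gt0|x sol]; last first.
  apply: (dissipation_cvg0 c_gt0 (x_ge0 x) (decrease_along_solution sol)) => k.
  by apply: le_trans (V_coercive _); rewrite mulr_ge0 ?normsq_ge0 // ltW.
have [b b_ge0 V_le] := V_dominated; have b1_gt0 : 0 < b + 1 by lra.
exists (a * eps / (b + 1)) => [|x sol init k]; first by rewrite divr_gt0 ?mulr_gt0.
have init_ge0 : 0 <= segment_normsq dM (segment x 0) by exact: bigmax_ge_id.
have init_lt : segment_normsq dM (segment x 0) * (b + 1) < a * eps.
  rewrite -ltr_pdivlMr //; apply: bigmax_lt => [|i _]; first by rewrite divr_gt0 ?mulr_gt0.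
  by apply: init; have := ltn_ord i; lia.
rewrite -(ltr_pM2l a_gt0) -segment_last; apply: le_lt_trans (V_coercive _) _.
have := dissipation_nonincreasing c_gt0 (x_ge0 x) (decrease_along_solution sol) (leq0n k).
have := V_le (segment x 0); lra.
Qed.

End KrasovskiiStability.

Section SupplyRate.
Variables (R : realType) (n m p : nat).
Variables (C : 'M[R]_(p, n)) (Q : 'M[R]_p) (S : 'M[R]_(p, m)) (Rm : 'M[R]_m).
Implicit Types (y : 'cV[R]_p) (u : 'cV[R]_m).
Local Notation part b := (slice (b * n) n).

Definition supply_rate y u : R := - qform Q y - 2 * bform S y u - qform Rm u.

Lemma qform_Upsilon (w : 'cV[R]_(8 * n + m)) :
  qform (Upsilon C Q Rm S) w = supply_rate (C *m part 3 w) (slice (8 * n) m w).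
Proof.
rewrite /qform /Upsilon /Upsilon1 !bformD bform_tr !bform_place !bformN bform_mulmx.
have -> : bform (Upsilon2 C S) w w = - bform S (C *m part 3 w) (slice (8 * n) m w).
  rewrite /Upsilon2 -[X in X *m _]mulmx1 bform_mulmx !place0_mulmx.
  rewrite mul1mx mulNmx linearNr /= -bform_mulmxr mul1mx.
  by rewrite -[C^T *m S]mulmx1 bform_mulmx mul1mx.
by rewrite /supply_rate /qform; ring.
Qed.

(* Completing the square, the difference is the Rm-form at u + Rm^-1 S^T y. *)
Lemma supply_rate_le_feedback y u : posdef Rm ->
  supply_rate y u <= supply_rate y (- (invmx Rm *m S^T) *m y).
Proof.
move=> pR; have [sR _] := pR; set v := _ *m y.
have bS t : bform S y t = - bform Rm t v.
  rewrite -bform_tr /bform -!mulmxA /v mulNmx !mulmxN -!mulmxA mulKVmx ?posdef_unitmx //.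
  by rewrite !mxE opprK.
have := posdef_ge0 (u - v) pR; rewrite qformB // /supply_rate !bS -/(qform Rm v); lra.
Qed.

Lemma qform_LMI3 rho y : Rm^T = Rm ->
  qform (LMI3 rho Q Rm S) (col_mx y ((rho *: ones R m p) *m y)) =
  - supply_rate y ((rho *: ones R m p) *m y).
Proof.
move=> sR; rewrite /LMI3 qform_block_mx bform_tr sR bform_mulmxr /supply_rate.
set w := _ *m y; have bS : bform (S *m (rho *: ones R m p)) y y = bform S y w.
  by rewrite bform_mulmxr.
have onesT : ones R p m = (ones R m p)^T by apply/matrixP => i j; rewrite !mxE.
rewrite /qform !bformD !bformN !bformZ onesT -trmx_mul bform_tr.
rewrite -bformZ scalemxAr bS; ring.
Qed.

Lemma feedback_supply_rate_ge0 rho y : posdef Rm -> negdef (LMI3 rho Q Rm S) ->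
  0 <= supply_rate y (- (invmx Rm *m S^T) *m y).
Proof.
move=> pR gain_LMI; have [sR _] := pR.
apply: le_trans (supply_rate_le_feedback y ((rho *: ones R m p) *m y) pR).
have := posdef_ge0 (col_mx y ((rho *: ones R m p) *m y)) gain_LMI.
by rewrite /qform bformN -/(qform _ _) qform_LMI3 // opprK.
Qed.

End SupplyRate.

Section ClosedLoop.
Variables (R : realType) (n m p dm dM : nat).
Variables (A : 'M[R]_n) (B : 'M[R]_(n, m)) (C : 'M[R]_(p, n)).
Variables (P : 'M[R]_(3 * n)) (W1 W2 Z1 Z2 : 'M[R]_n) (Rm : 'M[R]_m).
Variables (Q : 'M[R]_p) (S : 'M[R]_(p, m)) (X : 'M[R]_(2 * n)).
Local Notation part b := (slice (b * n) n).
Local Notation delay_LMI d :=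
  ((Gperp A B)^T *m (Phibar dm dM m P W1 W2 Z1 Z2 X d + Upsilon C Q Rm S) *m Gperp A B).

(* The columns of Gperp span the kernel of [-I A 0 ... 0 B]. *)
Lemma Gperp_slice (w : 'cV[R]_(8 * n + m)) :
  part 0 w = A *m part 1 w + B *m slice (8 * n) m w ->
  Gperp A B *m slice n (7 * n + m) w = w.
Proof.
rewrite mul0n mul1n => w0; apply: slice_inj => i i_p.
have [i_n|n_i] := ltnP i n.
  exists 0%N, n; split=> //.
  rewrite w0 /Gperp; slice_places; rewrite !slice_slice; try lia.
  by rewrite addn0; congr (_ + B *m slice _ _ _); lia.
exists n, (7 * n + m)%N; split; first by lia.
by rewrite /Gperp; slice_places; rewrite mul1mx slice_id.
Qed.

Lemma delay_LMI_dissipation d : negdef (delay_LMI d) ->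
  exists2 c : R, 0 < c & forall xi u,
    part 0 xi = A *m part 1 xi + B *m u ->
    qform (Phi dm dM P W1 W2 Z1 Z2 X d) xi + supply_rate Q S Rm (C *m part 3 xi) u
    <= - (c * normsq (part 1 xi)).
Proof.
move=> LMI; have [c c_gt0 LMI_coer] := posdef_coercive_mulmx (slice_mx R _ 0 n) LMI.
exists c => // xi u xi0; pose w := col_mx xi u.
have part_w b : (b < 8)%N -> part b w = part b xi.
  move=> b8; rewrite -[in RHS](slice_col_mxu xi u) slice_slice ?leq_addr //.
  by rewrite -mulSnr leq_mul2r b8 orbT.
have u_w : slice (8 * n) m w = u by exact: slice_col_mxd.
have GperpK : Gperp A B *m slice n (7 * n + m) w = w.
  by apply: Gperp_slice; rewrite !part_w // u_w.
have := LMI_coer (slice n (7 * n + m) w).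
have -> : slice_mx R _ 0 n *m slice n (7 * n + m) w = part 1 xi.
  by rewrite -/(slice 0 n _) slice_slice -?part_w ?mul1n ?addn0 //; lia.
rewrite /qform bformN bform_mulmx GperpK bformD.
rewrite -/(qform (Upsilon _ _ _ _) w) qform_Upsilon part_w // u_w.
rewrite /Phibar bform_place slice_col_mxu -/(qform _ _); lra.
Qed.

Lemma lkf_dissipation rho :
  (0 < dm)%N -> (dm <= dM)%N -> posdef P -> posdef Z1 -> posdef Z2 -> posdef Rm ->
  posdef (Psiz Z2 X) -> negdef (delay_LMI dm) -> negdef (delay_LMI dM) ->
  negdef (LMI3 rho Q Rm S) ->
  exists2 c : R, 0 < c & forall d h, (dm <= d <= dM)%N ->
    h dM.+1 = A *m h dM + B *m - (invmx Rm *m S^T) *m C *m h (dM - d)%N ->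
    lkf dm dM P W1 W2 Z1 Z2 (h \o succn) - lkf dm dM P W1 W2 Z1 Z2 h
    <= - (c * normsq (h dM)).
Proof.
move=> dm_gt0 dm_le_dM pP pZ1 pZ2 pR pPsi /delay_LMI_dissipation[c1 c1_gt0 diss_dm].
move=> /delay_LMI_dissipation[c2 c2_gt0 diss_dM] gain_LMI.
exists (Num.min c1 c2) => [|d h d_bounds step]; first by rewrite lt_min c1_gt0.
have [sP _] := pP.
apply: le_trans (lkf_decrease W1 W2 dm_le_dM h d_bounds dm_gt0 sP pZ1 pZ2 pPsi) _.
set xi := stack _ _; pose y := C *m h (dM - d)%N.
have supply_ge0 := feedback_supply_rate_ge0 y pR gain_LMI.
have xi_step : part 0 xi = A *m part 1 xi + B *m (- (invmx Rm *m S^T) *m y).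
  by rewrite !slice_lags //= step !mulmxA.
have bound c q : Num.min c1 c2 <= c ->
    q + supply_rate Q S Rm y (- (invmx Rm *m S^T) *m y) <= - (c * normsq (part 1 xi)) ->
    q <= - (Num.min c1 c2 * normsq (h dM)).
  rewrite slice_lags //= => min_le q_le; apply: (@le_trans _ _ (- (c * normsq (h dM)))).
    by apply: le_trans q_le; rewrite lerDl.
  by rewrite lerN2 ler_wpM2r ?normsq_ge0.
have y_xi : y = C *m part 3 xi by rewrite slice_lags.
apply: (qform_Phi_interp d_bounds).
- by apply: (bound c1); rewrite ?ge_min ?lexx // y_xi; apply: diss_dm; rewrite -y_xi.
- by apply: (bound c2); rewrite ?ge_min ?lexx ?orbT // y_xi; apply: diss_dM; rewrite -y_xi.
Qed.

End ClosedLoop.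

Theorem theorem1 (R : realType) (n m p dm dM : nat)
  (A : 'M[R]_n) (B : 'M[R]_(n, m)) (C : 'M[R]_(p, n))
  (rho : R)
  (P : 'M[R]_(3 * n)%N) (W1 W2 Z1 Z2 : 'M[R]_n) (Rm : 'M[R]_m)
  (Q : 'M[R]_p) (S : 'M[R]_(p, m)) (X : 'M[R]_(2 * n)%N) :
  controllable A B ->
  (1 <= dm)%N -> (dm <= dM)%N ->
  posdef P -> posdef W1 -> posdef W2 -> posdef Z1 -> posdef Z2 -> posdef Rm ->
  symmx Q ->
  posdef (Psiz Z2 X) ->
  (forall d : nat, d = dm \/ d = dM ->
     negdef ((Gperp A B)^T
             *m (Phibar dm dM m P W1 W2 Z1 Z2 X d + Upsilon C Q Rm S)
             *m Gperp A B)) ->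
  negdef (LMI3 rho Q Rm S) ->
  forall d : nat -> nat, (forall k, dm <= d k <= dM)%N ->
    asymp_stable A B (- (invmx Rm *m S^T)) C dM d.
Proof.
move=> _ dm_gt0 dm_le_dM pP pW1 pW2 pZ1 pZ2 pR _ pPsi delay_LMI gain_LMI d d_bounds.
have [a a_gt0 coercive] := lkf_coercive dm dM pP pW1 pW2 pZ1 pZ2.
have [c c_gt0 dissipative] := lkf_dissipation dm_gt0 dm_le_dM pP pZ1 pZ2 pR pPsi
  (delay_LMI dm (or_introl erefl)) (delay_LMI dM (or_intror erefl)) gain_LMI.
apply: (krasovskii_asymp_stable _ a_gt0 c_gt0 coercive (dominated_lkf dm dM P W1 W2 Z1 Z2)).
  by move=> k; case/andP: (d_bounds k).
by move=> k h; exact: dissipative.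
Qed.
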